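(* Let $(S_i,\sigma_{ij})_{i\in\mathbb{N}}$ and $(T_i,\tau_{ij})_{i\in\mathbb{N}}$ be two inductive sequences of uniformly based $\mathrm{Cu}$-semigroups, with inductive limits $(S,\sigma_{i\infty})_i$ and $(T,\tau_{i\infty})_i$ in the category $\mathrm{Cu}$. For each $i\in\mathbb{N}$ fix a uniform basis $(M_n^{S_i},\epsilon_n^{S_i})_n$ of $S_i$ and a uniform basis $(M_n^{T_i},\epsilon_n^{T_i})_n$ of $T_i$. Suppose that for every $i\in\mathbb{N}$ there are $\mathrm{Cu}$-morphisms $c_i:S_i\to T_i$ and $d_i:T_i\to S_{i+1}$, and that there are strictly increasing sequences of natural numbers $(n_i)_i$ and $(m_i)_i$ such that: (i) for all $i\le j$, $\sigma_{ij}(M^{S_i}_{n_j})\subseteq M^{S_j}_{n_j}$ and $\tau_{ij}(M^{T_i}_{m_j})\subseteq M^{T_j}_{m_j}$, where $\sigma_{ij}=\sigma_{j-1\,j}\circ\dots\circ\sigma_{i\,i+1}$ and $\tau_{ij}=\tau_{j-1\,j}\circ\dots\circ\tau_{i\,i+1}$; (ii) for all $i\in\mathbb{N}$, $d_i\circ c_i$ and $\sigma_{i\,i+1}$ strictly compare on $M^{S_i}_{n_i}$, and $c_{i+1}\circ d_i$ and $\tau_{i\,i+1}$ strictly compare on $M^{T_i}_{m_i}$; (iii) for all $i\in\mathbb{N}$, $c_i(M^{S_i}_{n_i})\subseteq M^{T_i}_{m_i}$ and $d_i(M^{T_i}_{m_i})\subseteq M^{S_{i+1}}_{n_{i+1}}$.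 Then $S\simeq T$ as $\mathrm{Cu}$-semigroups.
   Context: $\mathbb{N}$ contains $0$. A positively ordered monoid (PoM) is a commutative monoid with a translation-invariant partial order $\le$ for which $0$ is the least element; a PoM-morphism is an order-preserving monoid homomorphism. In a PoM $S$, write $x\ll y$ if for every increasing sequence $(z_n)_n$ in $S$ having a supremum with $\sup_n z_n\ge y$ there is $k$ with $x\le z_k$. A $\mathrm{Cu}$-semigroup is a PoM $S$ such that: (O1) every increasing sequence has a supremum; (O2) every $x\in S$ is the supremum of a $\ll$-increasing sequence ($x_n\ll x_{n+1}$); (O3) $x'\ll x$ and $y'\ll y$ imply $x'+y'\ll x+y$; (O4) $\sup_n(x_n+y_n)=\sup_n x_n+\sup_n y_n$ for increasing sequences. A $\mathrm{Cu}$-morphism is a PoM-morphism preserving $\ll$ and suprema of increasing sequences. $\mathrm{Cu}$ is the resulting category. Let $S_\ll=\{s\in S: \exists t\in S,\ s\ll t\}$ and, for $s\in S$, $s_\ll=\{s'\in S: s'\ll s\}$. A map $\epsilon$ between PoMs is super-additive if $\epsilon(g)+\epsilon(h)\le\epsilon(g+h)$ for all $g,h$. A uniform basis of $S$ is a countable family $(M_n,\epsilon_n)_{n\in\mathbb{N}}$, where $M_n$ is a PoM contained in $S_\ll$ and $\epsilon_n:S_\ll\to M_n$ is order-preserving and super-additive, such that: (U1) $(M_n)_n$ is $\subseteq$-increasing (with the convention $M_{-2}=M_{-1}=M_0=\{0\}$); (U2) for every $n$, the restriction of $\epsilon_n$ to $\bigcup_{l<n-1}M_l$ is a PoM-morphism;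 (U3) for every $s\in S_\ll$, $(\epsilon_n(s))_n$ is an increasing sequence in $s_\ll$ with supremum $s$; (U4) $(\epsilon_n(s))_{n>l}$ is $\ll$-increasing whenever $s\in M_l$. $S$ is uniformly based if it has a uniform basis. Two $\mathrm{Cu}$-morphisms $\alpha,\beta:S\to T$ strictly compare on $\Lambda\subseteq S$ (written $\alpha\underset{\Lambda}{\approx}\beta$) if for all $g',g\in\Lambda$ with $g'\ll g$ in $S$ one has $\alpha(g')\ll\beta(g)$ and $\beta(g')\ll\alpha(g)$. *)

(* Defs.v *)
From Stdlib Require Relation_Definitions.
From HB Require Import structures.
From mathcomp Require Import all_boot all_order all_algebra.
From mathcomp Require Import boolp classical_sets.

Set Implicit Arguments.
Unset Strict Implicit.
Unset Printing Implicit Defensive.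

Local Open Scope classical_set_scope.
Local Open Scope ring_scope.

Declare Scope pom_scope.
Delimit Scope pom_scope with pom.

(* The order is a Prop-valued relation on an nmodType: Hierarchy-Builder only *)
(* allows one structure joining addition and porderType, and that one, namely *)
(* porderZmodType, consists of groups. The choiceType underlying an nmodType  *)
(* is no restriction under the classical axioms of boolp.                     *)
HB.mixin Record isPoM S of GRing.Nmodule S := {
  pom_le : S -> S -> Prop ;
  pom_le_order : Relation_Definitions.order S pom_le ;
  pom_leD2l : forall z x y : S, pom_le x y -> pom_le (z + x) (z + y) ;
  pom_le0x : forall x : S, pom_le 0 x
}.

#[short(type="pomType")]
HB.structure Definition PoM := { S of GRing.Nmodule S & isPoM S }.

Notation "x <= y" := (pom_le x y) : pom_scope.

Local Open Scope pom_scope.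

Definition increasing (S : pomType) (z : nat -> S) : Prop :=
  {homo z : m n / (m <= n)%N >-> m <= n}.

Definition is_sup (S : pomType) (z : nat -> S) (s : S) : Prop :=
  (forall n, z n <= s) /\ forall u, (forall n, z n <= u) -> s <= u.

Definition way_below (S : pomType) (x y : S) : Prop :=
  forall (z : nat -> S) (s : S), increasing z -> is_sup z s -> y <= s ->
    exists k, x <= z k.

Notation "x <<< y" := (way_below x y) (at level 70, no associativity) : pom_scope.

HB.mixin Record isCu S of PoM S := {
  cu_O1 : forall z : nat -> S, increasing z -> exists s, is_sup z s ;
  cu_O2 : forall x : S, exists z : nat -> S,
    (forall n, z n <<< z n.+1) /\ is_sup z x ;
  cu_O3 : forall x' x y' y : S, x' <<< x -> y' <<< y -> x' + y' <<< x + y ;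
  cu_O4 : forall (x y : nat -> S) (a b : S), increasing x -> increasing y ->
    is_sup x a -> is_sup y b -> is_sup (fun n => x n + y n) (a + b)
}.

#[short(type="cuType")]
HB.structure Definition Cu := { S of PoM S & isCu S }.

Record cu_morphism (S T : cuType) (f : S -> T) : Prop := CuMorphism {
  cu_mor_nmod : GRing.nmod_morphism f ;
  cu_mor_le : {homo f : x y / x <= y} ;
  cu_mor_way_below : forall x y : S, x <<< y -> f x <<< f y ;
  cu_mor_sup : forall (z : nat -> S) (s : S),
    increasing z -> is_sup z s -> is_sup (f \o z) (f s)
}.

Definition cu_iso (S T : cuType) : Prop :=
  exists (f : S -> T) (g : T -> S),
    [/\ cu_morphism f, cu_morphism g, cancel f g & cancel g f].

(* Only the maps sigma i j with i <= j are meaningful. *)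
Record inductive_sequence (S : nat -> cuType) (sigma : forall i j, S i -> S j)
    : Prop := InductiveSequence {
  ind_mor : forall i j, (i <= j)%N -> cu_morphism (sigma i j) ;
  ind_id : forall i, sigma i i =1 id ;
  ind_comp : forall i j k, (i <= j)%N -> (j <= k)%N ->
    sigma j k \o sigma i j =1 sigma i k
}.

Definition cocone (S : nat -> cuType) (sigma : forall i j, S i -> S j)
    (V : cuType) (f : forall i, S i -> V) : Prop :=
  (forall i, cu_morphism (f i)) /\
  (forall i j, (i <= j)%N -> f j \o sigma i j =1 f i).

Definition inductive_limit (S : nat -> cuType) (sigma : forall i j, S i -> S j)
    (L : cuType) (iota : forall i, S i -> L) : Prop :=
  cocone sigma iota /\
  forall (V : cuType) (f : forall i, S i -> V), cocone sigma f ->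
    exists! h : L -> V, cu_morphism h /\ forall i, h \o iota i =1 f i.

Definition ll_part (S : pomType) : set S :=
  [set s | exists t, s <<< t].

(* M n is a PoM for the addition and order inherited from S. The map eps n is *)
(* total, but only its values on ll_part S are constrained.                   *)
Record uniform_basis (S : cuType) := UniformBasis {
  ub_set : nat -> set S ;
  ub_map : nat -> S -> S ;
  ub_set0 : forall n, ub_set n 0 ;
  ub_setD : forall n x y, ub_set n x -> ub_set n y -> ub_set n (x + y) ;
  ub_set_sub : forall n, ub_set n `<=` @ll_part S ;
  ub_map_in : forall n s, ll_part s -> ub_set n (ub_map n s) ;
  ub_map_le : forall n s t, ll_part s -> ll_part t ->
    s <= t -> ub_map n s <= ub_map n t ;
  ub_map_superadd : forall n s t, ll_part s -> ll_part t ->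
    ub_map n s + ub_map n t <= ub_map n (s + t) ;
  ub_U1_0 : ub_set 0 = [set 0] ;
  ub_U1 : forall m n, (m <= n)%N -> ub_set m `<=` ub_set n ;
  (* The set D is the union of the M l over l < n - 1; since l may be -1 or   *)
  (* -2, with M l = {0}, it always contains 0.                                *)
  ub_U2 : forall n,
    let D := [set 0] `|` \bigcup_(l in [set l | (l.+1 < n)%N]) ub_set l in
    [/\ ub_map n 0 = 0,
        forall s t, D s -> D t -> ub_map n (s + t) = ub_map n s + ub_map n t &
        forall s t, D s -> D t -> s <= t -> ub_map n s <= ub_map n t] ;
  ub_U3 : forall s, ll_part s ->
    [/\ increasing (ub_map^~ s), forall n, ub_map n s <<< s &
        is_sup (ub_map^~ s) s] ;
  ub_U4 : forall l s, ub_set l s ->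
    forall n, (l < n)%N -> ub_map n s <<< ub_map n.+1 s
}.

Definition strictly_compare (S T : cuType) (alpha beta : S -> T)
    (Lambda : set S) : Prop :=
  forall g' g, Lambda g' -> Lambda g -> g' <<< g ->
    alpha g' <<< beta g /\ beta g' <<< alpha g.

(* Main.v *)
(* Comparing on an increasing sequence of subsets is stable under composition,
   so on the [i]-th set the whole zigzag [d c ... d c] compares with [sigma i j],
   and the zigzag [c d ... c d] with [tau i j], at the cost of one [<<<]-step
   whatever [j] is.  Hence, for [x' <<< x] in [S i], the elements
   [tauinf j (c j (sigma i j x'))] are below [tauinf k (c k (sigma i k x))] for
   all large [j] and [k], in either order.  Sequences of Cu-morphisms with this
   Cauchy property converge to a Cu-morphism; the limits form a cocone and
   induce [Sinf -> Tinf].  The [d j] similarly give [Tinf -> Sinf], and the two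
   composites agree with the identity up to one [<<<]-step, hence are equal to
   it. *)
Require Import Defs.
From mathcomp Require Import all_boot all_order all_algebra.
From mathcomp Require Import boolp classical_sets.

Local Open Scope classical_set_scope.

Section UniformIntertwining.
Set Implicit Arguments.
Unset Strict Implicit.
Unset Printing Implicit Defensive.
Local Open Scope ring_scope.
Local Open Scope pom_scope.

(** * The order and the way-below relation *)

Lemma pom_le_refl (S : pomType) (x : S) : x <= x.
Proof. by case: (@pom_le_order S) => + _ _; apply. Qed.

Lemma pom_le_trans (S : pomType) (y x z : S) : x <= y -> y <= z -> x <= z.
Proof. by case: (@pom_le_order S) => _ + _; apply. Qed.

Lemma pom_le_anti (S : pomType) (x y : S) : x <= y -> y <= x -> x = y.
Proof. by case: (@pom_le_order S) => _ _; apply. Qed.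

Lemma pom_leD (S : pomType) (x x' y y' : S) :
  x <= x' -> y <= y' -> x + y <= x' + y'.
Proof.
move=> lex ley; apply: (@pom_le_trans _ (x + y')); first exact: pom_leD2l.
by rewrite ![_ + y']GRing.addrC; exact: pom_leD2l.
Qed.

Lemma increasing_step (S : pomType) (z : nat -> S) :
  (forall k, z k <= z k.+1) -> increasing z.
Proof.
move=> zS m n /subnK <-; elim: (n - m)%N => [|k IH]; first exact: pom_le_refl.
exact: pom_le_trans IH (zS _).
Qed.

Lemma way_below_le (S : pomType) (x y : S) : x <<< y -> x <= y.
Proof.
move=> xy; case: (xy (fun=> y) y) => //; last exact: pom_le_refl.
  by move=> *; exact: pom_le_refl.
by split=> [_|u /(_ 0%N)] //; exact: pom_le_refl.
Qed.

Lemma way_below_le_trans (S : pomType) (y x z : S) :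
  x <<< y -> y <= z -> x <<< z.
Proof. by move=> xy yz w s wi ws zs; exact: (xy w s wi ws (pom_le_trans yz zs)). Qed.

Lemma le_way_below_trans (S : pomType) (y x z : S) :
  x <= y -> y <<< z -> x <<< z.
Proof.
move=> xy yz w s wi ws zs; have [k yk] := yz w s wi ws zs.
by exists k; exact: pom_le_trans yk.
Qed.

Lemma way_below_trans (S : pomType) (y x z : S) :
  x <<< y -> y <<< z -> x <<< z.
Proof. by move=> xy /way_below_le; exact: way_below_le_trans. Qed.

Lemma way_below_is_sup (S : pomType) (z : nat -> S) (s x : S) :
  increasing z -> is_sup z s -> x <<< s -> exists k, x <= z k.
Proof. by move=> zi zs xs; exact: (xs z s zi zs (pom_le_refl s)). Qed.

Lemma cu_approx (S : cuType) (s : S) : exists z : nat -> S,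
  [/\ forall k, z k <<< z k.+1, forall k, z k <<< s, increasing z & is_sup z s].
Proof.
have [z [zS zs]] := cu_O2 s; exists z; split=> //.
  by move=> k; apply: way_below_le_trans (zS k) _; exact: zs.1.
by apply: increasing_step => k; exact: way_below_le.
Qed.

(** This is the substitute for halving an epsilon when approximate inequalities are chained. *)
Lemma way_below_interpolation (S : cuType) (x' x : S) :
  x' <<< x -> exists y, x' <<< y /\ y <<< x.
Proof.
move=> x'x; have [z [zS zx zi zs]] := cu_approx x.
have [k x'k] := way_below_is_sup zi zs x'x.
by exists (z k.+1); split=> //; exact: le_way_below_trans x'k (zS k).
Qed.

(** * Cu-morphisms and limits of sequences of them *)

Lemma cu_morphism_le_of_way_below (S T : cuType) (f g : S -> T) (x : S) (v : T) :
  cu_morphism f -> (forall x', x' <<< x -> f x' <= v) -> f x <= v.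
Proof.
move=> hf fv; have [z [_ zx zi zs]] := cu_approx x.
by have [_] := cu_mor_sup hf zi zs; apply => k; exact: fv.
Qed.

Lemma cu_morphism_comp (S T U : cuType) (g : T -> U) (f : S -> T) :
  cu_morphism g -> cu_morphism f -> cu_morphism (g \o f).
Proof.
move=> hg hf; split.
- case: (cu_mor_nmod hf) (cu_mor_nmod hg) => f0 fD [g0 gD].
  by split=> [|x y] /=; [rewrite f0|rewrite fD gD].
- by move=> x y xy; apply: (cu_mor_le hg); exact: cu_mor_le.
- by move=> x y xy; apply: (cu_mor_way_below hg); exact: cu_mor_way_below.
move=> z s zi zs; apply: (cu_mor_sup hg (z := f \o z)).
  by move=> i j ij; apply: (cu_mor_le hf); exact: zi.
exact: (cu_mor_sup hf).
Qed.

Lemma cu_morphism_id (S : cuType) : cu_morphism (@id S).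
Proof. by split. Qed.

(* [f] plays the role of the pointwise limit of [gamma]; the defects [x' <<< x]
   replace the epsilons of a metric. *)
Definition cu_cvg (S T : cuType) (gamma : nat -> S -> T) (f : S -> T) : Prop :=
  forall x' x : S, x' <<< x -> exists J, forall j, (J <= j)%N ->
    gamma j x' <= f x /\ f x' <= gamma j x.

(** No order between [j] and [k] is imposed, so early terms bound later ones and conversely. *)
Definition cu_cauchy (S T : cuType) (gamma : nat -> S -> T) : Prop :=
  forall x' x : S, x' <<< x -> exists J, forall j k,
    (J <= j)%N -> (J <= k)%N -> gamma j x' <= gamma k x.

(** If [x' <<< y] and [y <<< x], a single far term gives [f1 x' <= gamma j y <= f2 x]; then let [x']
    increase to [x]. *)
Lemma cu_cvg_unique (S T : cuType) (gamma : nat -> S -> T) (f g : S -> T) :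
  cu_morphism f -> cu_morphism g -> cu_cvg gamma f -> cu_cvg gamma g -> f =1 g.
Proof.
have le_fg f1 f2 : cu_morphism f1 -> cu_cvg gamma f1 -> cu_cvg gamma f2 ->
    forall x, f1 x <= f2 x.
  move=> h1 c1 c2 x; apply: cu_morphism_le_of_way_below => // x' x'x.
  have [y [x'y yx]] := way_below_interpolation x'x.
  have [J1 /(_ (maxn J1 _) (leq_maxl _ _)) H1] := c1 _ _ x'y.
  have [J2 /(_ (maxn J1 J2) (leq_maxr _ _)) [H2 _]] := c2 _ _ yx.
  exact: pom_le_trans (H1 J2).2 H2.
by move=> hf hg cf cg x; apply: pom_le_anti; apply: le_fg.
Qed.

Section Limit.
Variables (S T : cuType) (gamma : nat -> S -> T) (J0 : nat).
Hypothesis gamma_mor : forall j, (J0 <= j)%N -> cu_morphism (gamma j).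
Hypothesis gammaC : cu_cauchy gamma.

(** The limit at [s] will be the least such [v]. Testing on [x <<< s] instead of [s] itself is what
    makes the limit preserve suprema. *)
Definition eventual_ub (s : S) (v : T) : Prop :=
  forall x, x <<< s -> exists J, forall j, (J <= j)%N -> gamma j x <= v.

(** Only increasing sequences have suprema in [T], so the bound is obtained as the supremum of a
    diagonal sequence made increasing by [gammaC]. *)
Lemma least_eventual_ub (s : S) :
  exists u, eventual_ub s u /\ forall v, eventual_ub s v -> u <= v.
Proof.
have [z [zS zs zi zsup]] := cu_approx s.
have /choice [J hJ] : forall k, exists J, forall j l,
    (J <= j)%N -> (J <= l)%N -> gamma j (z k) <= gamma l (z k.+1).
  by move=> k; exact: gammaC.
(* Partial sums make [K] monotone, so [K k] and [K k.+1] are both past the threshold [J k]. *)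
pose K k := (\sum_(i < k.+1) J i)%N.
have JK k : (J k <= K k)%N by rewrite /K big_ord_recr /= leq_addl.
have KS k : (K k <= K k.+1)%N by rewrite {2}/K big_ord_recr /= leq_addr.
pose t k := gamma (K k) (z k).
have ti : increasing t.
  by apply: increasing_step => k; apply: hJ => //; exact: leq_trans (KS k).
have [u [ut umin]] := cu_O1 t ti; exists u; split=> [x xs|v vs].
  have [k xk] := way_below_is_sup zi zsup xs.
  exists (maxn J0 (J k)) => j; rewrite geq_max => /andP[J0j Jj].
  apply: pom_le_trans (ut k.+1).
  apply: pom_le_trans (cu_mor_le (gamma_mor J0j) xk) _.
  by apply: hJ => //; exact: leq_trans (KS k).
apply: umin => k; have [L hL] := vs _ (zs k.+1).
apply: pom_le_trans (hL (maxn L (J k)) (leq_maxl _ _)).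
by apply: hJ => //; exact: leq_maxr.
Qed.

Lemma cu_cauchy_cvg : exists f : S -> T, cu_morphism f /\ cu_cvg gamma f.
Proof.
have /choice [f hf] := least_eventual_ub.
have fub s x : x <<< s -> exists J, forall j, (J <= j)%N -> gamma j x <= f s.
  exact: (hf s).1.
have fmin s v : eventual_ub s v -> f s <= v by exact: (hf s).2.
have fcvg : cu_cvg gamma f.
  move=> x' x x'x; have [J hJ] := gammaC x'x; have [L hL] := fub _ _ x'x.
  exists (maxn J L) => j; rewrite geq_max => /andP[Jj Lj]; split; first exact: hL.
  (* For large [l], [gamma l y <= gamma l x' <= gamma j x], so [gamma j x] is an eventual bound for
     [x']. *)
  apply: fmin => y yx'; exists (maxn J0 J) => l; rewrite geq_max => /andP[J0l Jl].
  apply: pom_le_trans (hJ l j Jl Jj).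
  by apply: (cu_mor_le (gamma_mor J0l)); exact: way_below_le.
have fle : {homo f : x y / x <= y}.
  move=> x y xy; apply: fmin => w wx.
  by apply: fub; exact: way_below_le_trans wx xy.
have fsup (z : nat -> S) s : increasing z -> is_sup z s -> is_sup (f \o z) (f s).
  move=> zi zs; split=> [k|v vz]; first by apply: fle; exact: zs.1.
  apply: fmin => x xs; have [y [xy ys]] := way_below_interpolation xs.
  have [k yk] := way_below_is_sup zi zs ys.
  have [J hJ] := fub _ _ (way_below_le_trans xy yk).
  by exists J => j Jj; exact: pom_le_trans (hJ j Jj) (vz k).
exists f; split=> //; split=> //.
- split=> [|x y].
    apply: pom_le_anti (pom_le0x _); apply: fmin => x /way_below_le x0.
    exists J0 => j /gamma_mor hj; have -> : x = 0.
      exact: pom_le_anti x0 (pom_le0x _).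
    by rewrite (cu_mor_nmod hj).1; exact: pom_le0x.
  have [xs [xsS xsx xi xsup]] := cu_approx x.
  have [ys [ysS ysy yi ysup]] := cu_approx y.
  have xyi : increasing (fun k => xs k + ys k).
    by move=> i j ij; apply: pom_leD; [exact: xi|exact: yi].
  apply: pom_le_anti.
    apply: fmin => w wxy.
    have [k wk] := way_below_is_sup xyi (cu_O4 _ _ _ _ xi yi xsup ysup) wxy.
    have [J1 h1] := fub _ _ (xsx k); have [J2 h2] := fub _ _ (ysy k).
    exists (maxn J0 (maxn J1 J2)) => j.
    rewrite !geq_max => /and3P[/gamma_mor hj J1j J2j].
    apply: pom_le_trans (cu_mor_le hj wk) _; rewrite (cu_mor_nmod hj).2.
    by apply: pom_leD; [exact: h1|exact: h2].
  have fi (z : nat -> S) : increasing z -> increasing (f \o z).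
    by move=> zi i j ij; apply: fle; exact: zi.
  (* By (O4) in [T] it suffices to bound [f (xs k) + f (ys k)]. Passing to [gamma j] costs one step
     to [k.+1], and (O3) puts [xs k.+1 + ys k.+1] way below [x + y]. *)
  have [_] := cu_O4 _ _ _ _ (fi _ xi) (fi _ yi) (fsup _ _ xi xsup) (fsup _ _ yi ysup).
  apply=> k /=.
  have [J1 h1] := fcvg _ _ (xsS k); have [J2 h2] := fcvg _ _ (ysS k).
  have [J3 h3] := fub _ _ (cu_O3 _ _ _ _ (xsx k.+1) (ysy k.+1)).
  pose j := maxn (maxn J0 J1) (maxn J2 J3).
  have : (j <= j)%N by [].
  rewrite {1}/j !geq_max => /andP[/andP[/gamma_mor hj J1j] /andP[J2j J3j]].
  apply: pom_le_trans (h3 j J3j); rewrite (cu_mor_nmod hj).2.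
  by apply: pom_leD; [exact: (h1 j J1j).2|exact: (h2 j J2j).2].
(* The chain is [f x <= gamma j x1 <<< gamma j x2 <= f y]. *)
move=> x y xy; have [x1 [xx1 x1y]] := way_below_interpolation xy.
have [x2 [x12 x2y]] := way_below_interpolation x1y.
have [J1 h1] := fcvg _ _ xx1; have [J2 h2] := fub _ _ x2y.
pose j := maxn J0 (maxn J1 J2).
have : (j <= j)%N by [].
rewrite {1}/j !geq_max => /and3P[/gamma_mor hj J1j J2j].
apply: le_way_below_trans (h1 j J1j).2 _.
apply: way_below_le_trans (h2 j J2j).
exact: cu_mor_way_below.
Qed.

End Limit.

(** * Strict comparison and intertwinings *)

(** The first comparison yields [a x' <<< a' x], again a way-below pair inside [B], to which the
    second applies directly. Hence composing loses nothing further. *)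
Lemma strictly_compare_comp (S T U : cuType) (a a' : S -> T) (b b' : T -> U)
    (A : set S) (B : set T) :
  a @` A `<=` B -> a' @` A `<=` B ->
  strictly_compare a a' A -> strictly_compare b b' B ->
  strictly_compare (b \o a) (b' \o a') A.
Proof.
move=> aAB a'AB aa' bb' x' x Ax' Ax x'x; have [h1 h2] := aa' _ _ Ax' Ax x'x.
have Ba y : A y -> B (a y) by move=> Ay; apply: aAB; exists y.
have Ba' y : A y -> B (a' y) by move=> Ay; apply: a'AB; exists y.
split; first by have [] := bb' _ _ (Ba _ Ax') (Ba' _ Ax) h1.
by have [] := bb' _ _ (Ba' _ Ax') (Ba _ Ax) h2.
Qed.

(* What the intertwining argument uses of the uniform bases: [LS i] stands for
   [ub_set (BS i) (n i)] and [LT i] for [ub_set (BT i) (m i)].  The structure is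
   symmetric under [intertwining_shift], so only one direction is treated. *)
Record intertwining (S T : nat -> cuType)
    (sigma : forall i j, S i -> S j) (tau : forall i j, T i -> T j)
    (c : forall i, S i -> T i) (d : forall i, T i -> S i.+1)
    (LS : forall i, set (S i)) (LT : forall i, set (T i)) : Prop := Intertwining {
  itw_sigma : inductive_sequence sigma ;
  itw_tau : inductive_sequence tau ;
  itw_c : forall i, cu_morphism (c i) ;
  itw_d : forall i, cu_morphism (d i) ;
  itw_sigma_sub : forall i j, (i <= j)%N -> sigma i j @` LS i `<=` LS j ;
  itw_tau_sub : forall i j, (i <= j)%N -> tau i j @` LT i `<=` LT j ;
  itw_S_dense : forall i (x' x : S i), x' <<< x -> exists b J,
    [/\ x' <<< b, b <<< x &
        forall j, (i <= j)%N -> (J <= j)%N -> LS j (sigma i j b)] ;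
  itw_T_dense : forall i (x' x : T i), x' <<< x -> exists b J,
    [/\ x' <<< b, b <<< x &
        forall j, (i <= j)%N -> (J <= j)%N -> LT j (tau i j b)] ;
  itw_S_compare : forall i,
    strictly_compare (d i \o c i) (sigma i i.+1) (LS i) ;
  itw_T_compare : forall i,
    strictly_compare (c i.+1 \o d i) (tau i i.+1) (LT i) ;
  itw_c_sub : forall i, c i @` LS i `<=` LT i ;
  itw_d_sub : forall i, d i @` LT i `<=` LS i.+1
}.

(** Once [S 0] is dropped, [d i] joins equal indices and [c i.+1] raises the index by one, so the
    roles of [c] and [d] are exchanged. *)
Lemma intertwining_shift (S T : nat -> cuType)
    (sigma : forall i j, S i -> S j) (tau : forall i j, T i -> T j)
    (c : forall i, S i -> T i) (d : forall i, T i -> S i.+1)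
    (LS : forall i, set (S i)) (LT : forall i, set (T i)) :
  intertwining sigma tau c d LS LT ->
  @intertwining T (fun i => S i.+1) tau (fun i j => sigma i.+1 j.+1)
    d (fun i => c i.+1) LT (fun i => LS i.+1).
Proof.
move=> [hs ht hc hd ss ts sd td sc tc cs ds]; split=> //.
- split=> [i j ij|i|i j k ij jk]; first exact: (ind_mor hs).
    exact: (ind_id hs).
  exact: (ind_comp hs).
- by move=> i j ij; exact: ss.
move=> i x' x x'x; have [b [J [x'b bx bJ]]] := sd _ _ _ x'x.
by exists b, J; split=> // j ij Jj; apply: bJ => //; exact: leqW.
Qed.

Lemma cocone_shift (S : nat -> cuType) (sigma : forall i j, S i -> S j)
    (V : cuType) (f : forall i, S i -> V) :
  cocone sigma f ->
  @cocone (fun i => S i.+1) (fun i j => sigma i.+1 j.+1) V (fun i => f i.+1).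
Proof. by move=> [hf ff]; split=> // i j ij; exact: ff. Qed.

(** * Estimates for zigzags at finite stages *)

Section Intertwining.
Unset Implicit Arguments.
Variables (S T : nat -> cuType).
Variables (sigma : forall i j, S i -> S j) (tau : forall i j, T i -> T j).
Variables (c : forall i, S i -> T i) (d : forall i, T i -> S i.+1).
Variables (LS : forall i, set (S i)) (LT : forall i, set (T i)).
Set Implicit Arguments.
Hypothesis itw : intertwining sigma tau c d LS LT.

(** The map [z] is the zigzag of the maps [d \o c]. One [z] must serve both comparisons, since it is
    the link between the two ways around a square. *)
Lemma zigzag_compare j l : (j <= l)%N -> exists z : S j -> S l,
  [/\ z @` LS j `<=` LS l, strictly_compare z (sigma j l) (LS j) &
      strictly_compare (c l \o z) (tau j l \o c j) (LS j)].
Proof.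
move/subnK => <-; elim: (l - j)%N => [|k [z [zL zs zt]]].
  change (0 + j)%N with j.
  exists id; split=> [_ [x + <-] //| |] x' x Lx' Lx x'x /=.
    by rewrite !(ind_id (itw_sigma itw)).
  rewrite !(ind_id (itw_tau itw)).
  by split; exact: (cu_mor_way_below (itw_c itw j)).
have jk : (j <= k + j)%N by exact: leq_addl.
exists (d (k + j) \o c (k + j) \o z); split.
- move=> _ [x Lx <-]; apply: (itw_d_sub itw); exists (c (k + j)%N (z x)) => //.
  by apply: (itw_c_sub itw); exists (z x) => //; apply: zL; exists x.
- move=> x' x Lx' Lx x'x.
  have := strictly_compare_comp zL (itw_sigma_sub itw jk) zs
    (itw_S_compare (i := (k + j)%N) itw) Lx' Lx x'x.
  have e y : sigma (k + j)%N (k + j).+1 (sigma j (k + j)%N y) = sigma j (k + j).+1 y.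
    exact: (ind_comp (itw_sigma itw) jk (leqnSn _)).
  by rewrite /= !e.
have cz : (c (k + j)%N \o z) @` LS j `<=` LT (k + j)%N.
  move=> _ [x Lx <-]; apply: (itw_c_sub itw); exists (z x) => //.
  by apply: zL; exists x.
have tc : (tau j (k + j)%N \o c j) @` LS j `<=` LT (k + j)%N.
  move=> _ [x Lx <-]; apply: (itw_tau_sub itw jk); exists (c j x) => //.
  by apply: (itw_c_sub itw); exists x.
(* Reassociated, the longer zigzag is [c (k + j).+1 \o d (k + j)] after [c (k + j) \o z], so the
   comparison on [LT] applies. *)
move=> x' x Lx' Lx x'x.
have := strictly_compare_comp cz tc zt (itw_T_compare (i := (k + j)%N) itw) Lx' Lx x'x.
have e y : tau (k + j)%N (k + j).+1 (tau j (k + j)%N y) = tau j (k + j).+1 y.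
  exact: (ind_comp (itw_tau itw) jk (leqnSn _)).
by rewrite /= !e.
Qed.

(** Both sides are compared with [c l (z x)], at the cost of one [<<<]-step each. *)
Lemma square_compare j l (x' x y : S j) : (j <= l)%N ->
  LS j x' -> LS j x -> LS j y -> x' <<< x -> x <<< y ->
  tau j l (c j x') <<< c l (sigma j l y) /\
  c l (sigma j l x') <<< tau j l (c j y).
Proof.
move=> jl Lx' Lx Ly x'x xy; have [z [zL zs zt]] := zigzag_compare jl.
split.
  apply: way_below_trans (zt _ _ Lx' Lx x'x).2 _.
  by apply: (cu_mor_way_below (itw_c itw l)); exact: (zs _ _ Lx Ly xy).1.
apply: way_below_trans (zt _ _ Lx Ly xy).1.
by apply: (cu_mor_way_below (itw_c itw l)); exact: (zs _ _ Lx' Lx x'x).2.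
Qed.

(** Three elements [b1], [b2], [b3] are interpolated because [square_compare] needs all its
    arguments in [LS j]. The threshold constrains [j] and is uniform in [l]. *)
Lemma square_cauchy i (x' x : S i) : x' <<< x -> exists J, forall j l,
  (J <= j)%N -> (i <= j)%N -> (j <= l)%N ->
  tau j l (c j (sigma i j x')) <= c l (sigma i l x) /\
  c l (sigma i l x') <= tau j l (c j (sigma i j x)).
Proof.
move=> x'x; have [b1 [J1 [x'b1 b1x L1]]] := itw_S_dense itw x'x.
have [b2 [J2 [b12 b2x L2]]] := itw_S_dense itw b1x.
have [b3 [J3 [b23 b3x L3]]] := itw_S_dense itw b2x.
exists (maxn J1 (maxn J2 J3)) => j l; rewrite !geq_max => /and3P[J1j J2j J3j] ij jl.
have hs := ind_mor (itw_sigma itw) ij.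
have [h1 h2] := square_compare jl (L1 j ij J1j) (L2 j ij J2j) (L3 j ij J3j)
  (cu_mor_way_below hs b12) (cu_mor_way_below hs b23).
have il := leq_trans ij jl.
have hl := cu_morphism_comp (itw_c itw l) (ind_mor (itw_sigma itw) il).
have hj := cu_morphism_comp (ind_mor (itw_tau itw) jl)
  (cu_morphism_comp (itw_c itw j) (ind_mor (itw_sigma itw) ij)).
have e y : sigma j l (sigma i j y) = sigma i l y.
  exact: (ind_comp (itw_sigma itw) ij jl).
rewrite !e in h1 h2.
split.
  apply: pom_le_trans (cu_mor_le hj (way_below_le x'b1)) _.
  apply: pom_le_trans (way_below_le h1) _.
  exact: (cu_mor_le hl (way_below_le b3x)).
apply: pom_le_trans (cu_mor_le hl (way_below_le x'b1)) _.
apply: pom_le_trans (way_below_le h2) _.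
exact: (cu_mor_le hj (way_below_le b3x)).
Qed.

Lemma triangle_cauchy i (x' x : S i) : x' <<< x -> exists J, forall l,
  (J <= l)%N -> (i <= l)%N ->
  d l (c l (sigma i l x')) <= sigma i l.+1 x /\
  sigma i l.+1 x' <= d l (c l (sigma i l x)).
Proof.
move=> x'x; have [b1 [J1 [x'b1 b1x L1]]] := itw_S_dense itw x'x.
have [b2 [J2 [b12 b2x L2]]] := itw_S_dense itw b1x.
exists (maxn J1 J2) => l; rewrite geq_max => /andP[J1l J2l] il.
have hs := ind_mor (itw_sigma itw) il.
have hs' := ind_mor (itw_sigma itw) (leqW il).
have hdc := cu_morphism_comp (itw_d itw l) (cu_morphism_comp (itw_c itw l) hs).
have [/= h1 h2] := itw_S_compare itw (L1 l il J1l) (L2 l il J2l)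
  (cu_mor_way_below hs b12).
have e y : sigma l l.+1 (sigma i l y) = sigma i l.+1 y.
  exact: (ind_comp (itw_sigma itw) il (leqnSn l)).
rewrite !e in h1 h2; split.
  apply: pom_le_trans (cu_mor_le hdc (way_below_le x'b1)) _.
  apply: pom_le_trans (way_below_le h1) _.
  exact: (cu_mor_le hs' (way_below_le b2x)).
apply: pom_le_trans (cu_mor_le hs' (way_below_le x'b1)) _.
apply: pom_le_trans (way_below_le h2) _.
exact: (cu_mor_le hdc (way_below_le b2x)).
Qed.

(** The square replaces the path through [tau j l] by [c l \o sigma i l]; the triangle at stage [l]
    then removes [d l \o c l]. *)
Lemma loop_cauchy i (x' x : S i) : x' <<< x -> exists J, forall j l,
  (J <= j)%N -> (i <= j)%N -> (j <= l)%N ->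
  d l (tau j l (c j (sigma i j x'))) <= sigma i l.+1 x /\
  sigma i l.+1 x' <= d l (tau j l (c j (sigma i j x))).
Proof.
move=> x'x; have [y [x'y yx]] := way_below_interpolation x'x.
have [J1 h1] := square_cauchy x'y; have [J2 h2] := square_cauchy yx.
have [J3 h3] := triangle_cauchy x'y; have [J4 h4] := triangle_cauchy yx.
exists (maxn (maxn J1 J2) (maxn J3 J4)) => j l.
rewrite !geq_max => /andP[/andP[J1j J2j] /andP[J3j J4j]] ij jl.
have il := leq_trans ij jl.
split.
  apply: pom_le_trans (h4 l (leq_trans J4j jl) il).1.
  exact: (cu_mor_le (itw_d itw l) (h1 j l J1j ij jl).1).
apply: pom_le_trans (h3 l (leq_trans J3j jl) il).2 _.
exact: (cu_mor_le (itw_d itw l) (h2 j l J2j ij jl).2).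
Qed.

(** * Morphisms between the inductive limits *)

Variables (Sinf Tinf : cuType).
Unset Implicit Arguments.
Variables (sigmainf : forall i, S i -> Sinf) (tauinf : forall i, T i -> Tinf).
Set Implicit Arguments.
Hypothesis hS : inductive_limit sigma sigmainf.
Hypothesis hT : cocone tau tauinf.

(** For each [i] the sequence is Cauchy; uniqueness of limits makes the limits a cocone, which
    factors through [Sinf]. *)
Lemma intertwining_map : exists h : Sinf -> Tinf, cu_morphism h /\
  forall i, cu_cvg (fun j => tauinf j \o c j \o sigma i j) (h \o sigmainf i).
Proof.
have gamma_mor i j : (i <= j)%N -> cu_morphism (tauinf j \o c j \o sigma i j).
  move=> ij; apply: cu_morphism_comp (ind_mor (itw_sigma itw) ij).
  by apply: cu_morphism_comp (itw_c itw j); exact: hT.1.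
have gammaC i : cu_cauchy (fun j => tauinf j \o c j \o sigma i j).
  move=> x' x x'x; have [J hJ] := square_cauchy x'x.
  exists (maxn J i) => j k; rewrite !geq_max => /andP[Jj ij] /andP[Jk ik] /=.
  (* The lower stage is pushed to the higher one by [tau]; each case uses one half of
     [square_cauchy]. *)
  have [jk|/ltnW kj] := leqP j k.
    rewrite -(hT.2 _ _ jk); apply: (cu_mor_le (hT.1 k)).
    exact: (hJ j k Jj ij jk).1.
  rewrite -(hT.2 _ _ kj); apply: (cu_mor_le (hT.1 j)).
  exact: (hJ k j Jk ik kj).2.
have fex i : exists f : S i -> Tinf,
    cu_morphism f /\ cu_cvg (fun j => tauinf j \o c j \o sigma i j) f.
  exact: (cu_cauchy_cvg (gamma_mor i) (gammaC i)).
pose f i := projT1 (cid (fex i)).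
have hf i : cu_morphism (f i) /\
    cu_cvg (fun j => tauinf j \o c j \o sigma i j) (f i).
  exact: projT2 (cid (fex i)).
have [h [[hh hf'] _]] : exists! h : Sinf -> Tinf,
    cu_morphism h /\ forall i, h \o sigmainf i =1 f i.
  apply: hS.2; split=> [i|i j ij]; first exact: (hf i).1.
  apply: (@cu_cvg_unique _ _ (fun j => tauinf j \o c j \o sigma i j)).
  - exact: cu_morphism_comp (hf j).1 (ind_mor (itw_sigma itw) ij).
  - exact: (hf i).1.
  - move=> x' x x'x.
    have [J hJ] := (hf j).2 _ _ (cu_mor_way_below (ind_mor (itw_sigma itw) ij) x'x).
    exists (maxn J j) => l; rewrite geq_max => /andP[Jl jl].
    have e y : sigma j l (sigma i j y) = sigma i l y.
      exact: (ind_comp (itw_sigma itw) ij jl).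
    by have := hJ l Jl; rewrite /= !e.
  exact: (hf i).2.
by exists h; split=> // i x' x x'x; rewrite !hf'; exact: (hf i).2.
Qed.

(** On each stage, [k \o h \o sigmainf i] is a limit of the constant sequence [sigmainf i], hence
    equal to it; the universal property then forces [k \o h] to be the identity. *)
Lemma intertwining_mapK (h : Sinf -> Tinf) (k : Tinf -> Sinf) :
  cu_morphism h -> cu_morphism k ->
  (forall i, cu_cvg (fun j => tauinf j \o c j \o sigma i j) (h \o sigmainf i)) ->
  (forall i, cu_cvg (fun j => sigmainf j.+1 \o d j \o tau i j) (k \o tauinf i)) ->
  cancel h k.
Proof.
move=> hh hk hcvg kcvg; have [[sm sc] suniv] := hS.
have khs i : k \o (h \o sigmainf i) =1 sigmainf i.
  apply: (@cu_cvg_unique _ _ (fun=> sigmainf i)) => //.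
  - by apply: cu_morphism_comp hk _; exact: cu_morphism_comp hh _.
  - move=> x' x x'x; exists 0%N => _ _ /=.
    (* Three [<<<]-steps are spent: one on the convergence to [h], one on the convergence to [k],
       one on the loop. The index [j] is fixed first, as the threshold [L] for [k] depends on it. *)
    have [y2 [x'y2 y2x]] := way_below_interpolation x'x.
    have [y1 [x'y1 y12]] := way_below_interpolation x'y2.
    have [J1 h1] := hcvg _ _ _ x'y1; have [J2 h2] := hcvg _ _ _ y2x.
    have [J3 h3] := loop_cauchy x'y1; have [J4 h4] := loop_cauchy y2x.
    pose j := maxn (maxn i (maxn J1 J2)) (maxn J3 J4).
    have : (j <= j)%N by [].
    rewrite {1}/j !geq_max => /andP[/and3P[ij J1j J2j] /andP[J3j J4j]].
    have [L hL] := kcvg j _ _ (cu_mor_way_below (itw_c itw j)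
      (cu_mor_way_below (ind_mor (itw_sigma itw) ij) y12)).
    have [hL1 hL2] := hL _ (leq_maxr j L).
    have jl := leq_maxl j L; set l := maxn j L in hL1 hL2 jl.
    have il : (i <= l.+1)%N by apply: leqW; exact: leq_trans jl.
    have e y : sigmainf i y = sigmainf l.+1 (sigma i l.+1 y).
      by rewrite -(sc _ _ il y).
    split; last first.
      rewrite (e x).
      apply: pom_le_trans (cu_mor_le hk (h1 j J1j).2) _.
      apply: pom_le_trans hL2 _.
      exact: (cu_mor_le (sm l.+1) (h4 j l J4j ij jl).1).
    rewrite (e x').
    apply: pom_le_trans (cu_mor_le (sm l.+1) (h3 j l J3j ij jl).2) _.
    apply: pom_le_trans hL1 _.
    exact: (cu_mor_le hk (h2 j J2j).1).
  by move=> x' x x'x; exists 0%N => _ _; split;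
    exact: (cu_mor_le (sm i) (way_below_le x'x)).
have [g [_ guniq]] := suniv _ _ (conj sm sc).
have gkh : g = k \o h by apply: guniq; split=> //; exact: cu_morphism_comp.
have gid : g = id by apply: guniq; split=> //; exact: cu_morphism_id.
by move=> x; rewrite -[LHS]/((k \o h) x) -gkh gid.
Qed.

End Intertwining.

(** * From uniform bases to intertwinings *)

(** An interpolant [y <<< x] lies in [ll_part S], so by (U3) its approximants [ub_map B N y] are way
    below [y] and eventually exceed any element way below [y]. *)
Lemma uniform_basis_dense (S : cuType) (B : uniform_basis S) (x' x : S) :
  x' <<< x -> exists b N, [/\ x' <<< b, b <<< x & ub_set B N b].
Proof.
move=> x'x; have [y [x'y yx]] := way_below_interpolation x'x.
have [y1 [x'y1 y1y]] := way_below_interpolation x'y.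
have lly : ll_part y by exists x.
have [ei ey es] := ub_U3 B lly.
have [N y1N] := way_below_is_sup ei es y1y.
exists (ub_map B N y), N; split; last exact: ub_map_in.
  exact: way_below_le_trans y1N.
exact: way_below_trans (ey N) yx.
Qed.

(** Strict growth gives [j <= n j], so (U1) places an element of level [N] in level [n j] as soon as
    [N <= j]. *)
Lemma uniform_basis_eventually (S : nat -> cuType)
    (sigma : forall i j, S i -> S j) (B : forall i, uniform_basis (S i))
    (n : nat -> nat) :
  {homo n : i j / (i < j)%N} ->
  (forall i j, (i <= j)%N ->
    sigma i j @` ub_set (B i) (n j) `<=` ub_set (B j) (n j)) ->
  forall i (x' x : S i), x' <<< x -> exists b J,
    [/\ x' <<< b, b <<< x & forall j, (i <= j)%N -> (J <= j)%N ->
        ub_set (B j) (n j) (sigma i j b)].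
Proof.
move=> hn hB i x' x /(uniform_basis_dense (B i)) [b [N [x'b bx Nb]]].
have n_ge j : (j <= n j)%N.
  by elim: j => // j IH; apply: leq_ltn_trans IH _; exact: hn.
exists b, N; split=> // j ij Nj; apply: (hB i j ij); exists b => //.
exact: ub_U1 (leq_trans Nj (n_ge j)) _ Nb.
Qed.

Lemma uniform_basis_sub (S : nat -> cuType)
    (sigma : forall i j, S i -> S j) (B : forall i, uniform_basis (S i))
    (n : nat -> nat) :
  {homo n : i j / (i < j)%N} ->
  (forall i j, (i <= j)%N ->
    sigma i j @` ub_set (B i) (n j) `<=` ub_set (B j) (n j)) ->
  forall i j, (i <= j)%N ->
    sigma i j @` ub_set (B i) (n i) `<=` ub_set (B j) (n j).
Proof.
move=> hn hB i j ij _ [x Lx <-]; apply: (hB i j ij); exists x => //.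
have nij : (n i <= n j)%N.
  by move: ij; rewrite leq_eqVlt => /predU1P[-> //|/hn/ltnW].
exact: ub_U1 nij _ Lx.
Qed.

End UniformIntertwining.

Theorem theorem1p1
  (S T : nat -> cuType)
  (sigma : forall i j : nat, S i -> S j)
  (tau : forall i j : nat, T i -> T j)
  (hsigma : inductive_sequence sigma)
  (htau : inductive_sequence tau)
  (Sinf Tinf : cuType)
  (sigmainf : forall i : nat, S i -> Sinf)
  (tauinf : forall i : nat, T i -> Tinf)
  (hSinf : inductive_limit sigma sigmainf)
  (hTinf : inductive_limit tau tauinf)
  (BS : forall i : nat, uniform_basis (S i))
  (BT : forall i : nat, uniform_basis (T i))
  (c : forall i : nat, S i -> T i)
  (d : forall i : nat, T i -> S i.+1)
  (hc : forall i : nat, cu_morphism (c i))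
  (hd : forall i : nat, cu_morphism (d i))
  (n m : nat -> nat)
  (hn : {homo n : i j / (i < j)%N})
  (hm : {homo m : i j / (i < j)%N})
  (h1S : forall i j : nat, (i <= j)%N ->
    sigma i j @` ub_set (BS i) (n j) `<=` ub_set (BS j) (n j))
  (h1T : forall i j : nat, (i <= j)%N ->
    tau i j @` ub_set (BT i) (m j) `<=` ub_set (BT j) (m j))
  (h2S : forall i : nat,
    strictly_compare (d i \o c i) (sigma i i.+1) (ub_set (BS i) (n i)))
  (h2T : forall i : nat,
    strictly_compare (c i.+1 \o d i) (tau i i.+1) (ub_set (BT i) (m i)))
  (h3S : forall i : nat,
    c i @` ub_set (BS i) (n i) `<=` ub_set (BT i) (m i))
  (h3T : forall i : nat,
    d i @` ub_set (BT i) (m i) `<=` ub_set (BS i.+1) (n i.+1)) :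
  cu_iso Sinf Tinf.
Proof.
have itw : intertwining sigma tau c d
    (fun i => ub_set (BS i) (n i)) (fun i => ub_set (BT i) (m i)).
  split=> //.
  - exact: uniform_basis_sub.
  - exact: uniform_basis_sub.
  - exact: uniform_basis_eventually.
  - exact: uniform_basis_eventually.
have itw' := intertwining_shift itw.
have [h [hh hcvg]] := intertwining_map itw hSinf hTinf.1.
have [k [hk kcvg]] := intertwining_map itw' hTinf (cocone_shift hSinf.1).
exists h, k; split=> //.
  exact: (intertwining_mapK itw hSinf hh hk hcvg kcvg).
apply: (intertwining_mapK itw' hTinf hk hh kcvg).
(* The shifted intertwining asks for convergence of [tauinf j.+1 \o c j.+1 \o sigma i.+1 j.+1], a
   tail of the sequence for [i.+1]. *)
move=> i x' x x'x.
have [J hJ] := hcvg i.+1 _ _ x'x.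
by exists J => j Jj; apply: hJ; exact: leqW.
Qed.
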